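(* SESs and EBESs are incomparable: there exists an SES $\sigma$ such that no EBES has the same set of posets as $\sigma$, and there exists an EBES $\xi$ such that no SES has the same set of posets as $\xi$.
   Context: An SES is a tuple $\sigma=(E,\#,\to,\mathrm{Drop})$: $E$ a set of events, $\#\subseteq E^2$ irreflexive and symmetric, $\to\subseteq E^2$, $\mathrm{Drop}\subseteq E^3$ with $(d,c,t)\in\mathrm{Drop}$ implying $c\to t$ and $d\notin\{c,t\}$. Let $\mathrm{ic}(e)=\{e'\mid e'\to e\}$, $\mathrm{dc}(H,e)=\{e'\mid\exists d\in H.(d,e',e)\in\mathrm{Drop}\}$. For $t=e_1\cdots e_n$, $\overline t=\{e_1,\dots,e_n\}$, $t_i=e_1\cdots e_i$. A trace of $\sigma$ is a sequence of pairwise distinct, pairwise non-conflicting events with $\mathrm{ic}(e_i)\setminus\mathrm{dc}(\overline{t_{i-1}},e_i)\subseteq\overline{t_{i-1}}$ for all $i$. For a trace and sets $U_1\ne U_2$ of its events, $U_1$ is earlier than $U_2$ if the largest index $j$ with $e_j\in U_1\setminus U_2$ is smaller than the largest index $j$ with $e_j\in U_2\setminus U_1$. The cause $U_i$ of $e_i$ in $t$ is the earliest $U\subseteq\overline{t_{i-1}}$ with $\mathrm{ic}(e_i)\setminus\mathrm{dc}(U,e_i)\subseteq U$; the poset of $t$ is $(\overline t,\le)$ with $\le$ the reflexive transitive closure of $\{(c,e_i)\mid c\in U_i\}$; the posets of $\sigma$ are the posets of all its traces. An Extended Bundle Event Structure (EBES) is $\xi=(E,\rightsquigarrow,\mapsto)$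 with $E$ a set of events, $\rightsquigarrow\subseteq E^2$ irreflexive (disabling: $e\rightsquigarrow e'$ means $e'$ disables $e$), and $\mapsto\subseteq\mathcal P(E)\times E$ (bundles) such that $X\mapsto e$ implies $e_1\rightsquigarrow e_2$ for all distinct $e_1,e_2\in X$. A trace of $\xi$ is a sequence $e_1\cdots e_n$ of pairwise distinct events such that $e_i\rightsquigarrow e_j$ implies $i<j$, and every bundle $X\mapsto e_i$ satisfies $X\cap\overline{t_{i-1}}\ne\emptyset$. Configurations are the sets $\overline t$ of traces $t$. For a configuration $C$ and $e,e'\in C$, $e\prec_C e'$ iff $e\rightsquigarrow e'$ or $e\in X$ for some bundle $X\mapsto e'$; $\le_C$ is the reflexive transitive closure of $\prec_C$, and the set of posets of $\xi$ is $\{(C,\le_C)\mid C \text{ a configuration}\}$. *)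

(* Defs.v *)
From mathcomp Require Import all_boot.
From mathcomp Require Import boolp classical_sets cardinality.
From Stdlib Require Import Relation_Operators.

Set Implicit Arguments.
Unset Strict Implicit.
Unset Printing Implicit Defensive.

Local Open Scope classical_set_scope.

(* Event structures draw their events from an ambient type [Ev] of event names;
   the set of events of a structure is an arbitrary subset of [Ev], so that the
   posets of structures with different sets of events can be compared by
   equality. *)

(* A carrier together with the graph of an order on it, contained in the square
   of the carrier. *)
Definition eposet (Ev : Type) : Type := (set Ev * set (Ev * Ev))%type.

Definition eposet_of (Ev : Type) (C : set Ev) (R : Ev -> Ev -> Prop) :
    eposet Ev :=
  (C, [set p | [/\ C p.1, C p.2 & clos_refl_trans Ev R p.1 p.2]]).

Definition events (Ev : eqType) (t : seq Ev) : set Ev := [set e | e \in t].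

Record SES (Ev : Type) : Type := MkSES {
  ses_ev : set Ev;
  ses_conf : Ev -> Ev -> Prop;
  ses_cause : Ev -> Ev -> Prop;
  ses_drop : Ev -> Ev -> Ev -> Prop;
  ses_conf_ev : forall e e', ses_conf e e' -> ses_ev e /\ ses_ev e';
  ses_conf_irr : forall e, ~ ses_conf e e;
  ses_conf_sym : forall e e', ses_conf e e' -> ses_conf e' e;
  ses_cause_ev : forall e e', ses_cause e e' -> ses_ev e /\ ses_ev e';
  ses_drop_ev : forall d c t,
    ses_drop d c t -> [/\ ses_ev d, ses_ev c & ses_ev t];
  ses_drop_cause : forall d c t,
    ses_drop d c t -> [/\ ses_cause c t, d <> c & d <> t]
}.

Definition ic (Ev : Type) (s : SES Ev) (e : Ev) : set Ev :=
  [set e' | ses_cause s e' e].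

Definition dc (Ev : Type) (s : SES Ev) (H : set Ev) (e : Ev) : set Ev :=
  [set e' | exists2 d, H d & ses_drop s d e' e].

(* Positions are 0-based: for [i : 'I_(size t)], [tnth (in_tuple t) i] is
   e_(i+1) and [take i t] is t_i, the prefix that precedes it. *)
Definition ses_trace (Ev : eqType) (s : SES Ev) (t : seq Ev) : Prop :=
  [/\ events t `<=` ses_ev s,
      uniq t,
      forall e e', e \in t -> e' \in t -> ~ ses_conf s e e'
    & forall i : 'I_(size t),
        let e := tnth (in_tuple t) i in
        ic s e `\` dc s (events (take i t)) e `<=` events (take i t)].

(* The largest 1-based index of an event of [t] that lies in [A], and 0 if there
   is none. *)
Definition last_index (Ev : Type) (t : seq Ev) (A : set Ev) : nat :=
  \max_(i < size t | tnth (in_tuple t) i \in A) i.+1.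

Definition earlier (Ev : Type) (t : seq Ev) (U1 U2 : set Ev) : Prop :=
  last_index t (U1 `\` U2) < last_index t (U2 `\` U1).

Definition cause_candidate (Ev : eqType) (s : SES Ev) (t : seq Ev)
    (i : 'I_(size t)) (U : set Ev) : Prop :=
  let e := tnth (in_tuple t) i in
  U `<=` events (take i t) /\ ic s e `\` dc s U e `<=` U.

Definition is_cause (Ev : eqType) (s : SES Ev) (t : seq Ev)
    (i : 'I_(size t)) (U : set Ev) : Prop :=
  cause_candidate s i U /\
  forall U', cause_candidate s i U' -> U' <> U -> earlier t U U'.

Definition ses_prec (Ev : eqType) (s : SES Ev) (t : seq Ev) (c e : Ev) : Prop :=
  exists (i : 'I_(size t)) (U : set Ev),
    [/\ is_cause s i U, U c & e = tnth (in_tuple t) i].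

Definition ses_posets (Ev : eqType) (s : SES Ev) : set (eposet Ev) :=
  [set eposet_of (events t) (ses_prec s t) | t in ses_trace s].

Record EBES (Ev : Type) : Type := MkEBES {
  ebes_ev : set Ev;
  (* [ebes_dis e e']: e' disables e *)
  ebes_dis : Ev -> Ev -> Prop;
  ebes_bundle : set Ev -> Ev -> Prop;
  ebes_dis_ev : forall e e', ebes_dis e e' -> ebes_ev e /\ ebes_ev e';
  ebes_dis_irr : forall e, ~ ebes_dis e e;
  ebes_bundle_ev : forall X e,
    ebes_bundle X e -> X `<=` ebes_ev /\ ebes_ev e;
  ebes_bundle_dis : forall X e, ebes_bundle X e ->
    forall e1 e2, X e1 -> X e2 -> e1 <> e2 -> ebes_dis e1 e2
}.

Definition ebes_trace (Ev : eqType) (x : EBES Ev) (t : seq Ev) : Prop :=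
  [/\ events t `<=` ebes_ev x,
      uniq t,
      forall i j : 'I_(size t),
        ebes_dis x (tnth (in_tuple t) i) (tnth (in_tuple t) j) -> i < j
    & forall (i : 'I_(size t)) (X : set Ev),
        ebes_bundle x X (tnth (in_tuple t) i) ->
        X `&` events (take i t) !=set0].

Definition ebes_configs (Ev : eqType) (x : EBES Ev) : set (set Ev) :=
  [set events t | t in ebes_trace x].

Definition ebes_prec (Ev : Type) (x : EBES Ev) (C : set Ev) (e e' : Ev) : Prop :=
  [/\ C e, C e'
    & ebes_dis x e e' \/ exists2 X, ebes_bundle x X e' & X e].

Definition ebes_posets (Ev : eqType) (x : EBES Ev) : set (eposet Ev) :=
  [set eposet_of C (ebes_prec x C) | C in ebes_configs x].

(* Main.v *)
Require Import Defs.
From mathcomp Require Import all_boot.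
From mathcomp Require Import boolp classical_sets cardinality.
From Stdlib Require Import Relation_Operators.

Set Implicit Arguments.
Unset Strict Implicit.
Unset Printing Implicit Defensive.

Local Open Scope classical_set_scope.

(** An EBES has one poset per configuration. In the SES with [c -> t] where [d]
    drops this causality, the carrier {c, d, t} has two posets: the trace c d t
    yields c < t and the trace d c t yields d < t instead.

    Conversely, in the EBES where [b] disables [a] both {a} and {b} are
    configurations, and a < b in the configuration {a, b}. An SES with the
    posets {a} and {b} has [ic a] and [ic b] empty, so that both events have an
    empty cause in every trace and [a], [b] are never ordered. *)

Lemma infinite_setT_notin {T : eqType} (s : seq T) :
  infinite_set [set: T] -> exists x, x \notin s.
Proof.
move=> Tinf; apply: contrapT => /forallNP sT; apply: Tinf.
apply: (@sub_finite_set _ _ [set` s]); last exact: finite_seq.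
by move=> x _ /=; case: (boolP (x \in s)) => // xs; have := sT x.
Qed.

Section LastIndex.
Variables (T : Type) (t : seq T).

(** The 0-based bound is strict because [last_index] counts positions from 1. *)
Lemma last_index_leq (A : set T) (n : nat) :
  (forall i : 'I_(size t), A (tnth (in_tuple t) i) -> i < n) ->
  last_index t A <= n.
Proof. by move=> An; apply/bigmax_leqP => i /set_mem; exact: An. Qed.

Lemma ltn_last_index (A : set T) (i : 'I_(size t)) :
  A (tnth (in_tuple t) i) -> i < last_index t A.
Proof.
by move=> /mem_set Ai; apply: (bigmax_sup i).
Qed.

Lemma last_index0 : last_index t set0 = 0.
Proof. by apply/eqP; rewrite -leqn0; apply: last_index_leq => i []. Qed.

End LastIndex.

(** A nontrivial chain begins with a step of [R], whose source is [d]. *)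
Lemma clos_refl_trans_source {T : Type} (R : T -> T -> Prop) (d x y : T) :
  (forall u v, R u v -> u = d) ->
  clos_refl_trans T R x y -> x = y \/ x = d.
Proof.
by move=> Rd; elim=> {x y} [x y /Rd -> | x | x y z _ [-> | ->] _ //];
  [right | left | right].
Qed.

Section Ebes.
Variables (Ev : eqType) (x : EBES Ev).

Lemma ebes_posets_functional (C : set Ev) (R1 R2 : set (Ev * Ev)) :
  ebes_posets x (C, R1) -> ebes_posets x (C, R2) -> R1 = R2.
Proof. by case=> C1 _ [-> <-] [C2 _ [-> <-]]. Qed.

End Ebes.

Section Ses.
Variables (Ev : eqType) (s : SES Ev).

(** The trace starts with [a]; the empty prefix there contains no dropper, so all of [ic s a] must
    lie in the empty set. *)
Lemma ses_posets1_ic (a : Ev) (R : set (Ev * Ev)) :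
  ses_posets s ([set a], R) -> ic s a = set0.
Proof.
case=> t [_ _ _ tic] [ta _].
have aP z : z \in t <-> z = a by change (events t z <-> [set a] z); rewrite ta.
case: t => [|y t] in tic ta aP *; first by have /aP := erefl a.
have ya : y = a by apply/aP; rewrite mem_head.
have := tic ord0; rewrite (tnth_nth y) /= ya => icE.
rewrite -subset0 => c ac.
by suff : events [::] c by []; apply: icE; split=> // -[d].
Qed.

(** The empty set is a candidate for [e], and no other set is earlier: [last_index] of an empty
    difference is 0. *)
Lemma ic0_ses_prec (t : seq Ev) (c e : Ev) :
  ic s e = set0 -> ~ ses_prec s t c e.
Proof.
move=> ic0 [i [U [[_ Umin] Uc eE]]].
have U0 : set0 <> U by move=> U0; rewrite -U0 in Uc.
have cand0 : cause_candidate s i set0 by split=> //; rewrite -eE ic0 set0D.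
have : earlier t U set0 := Umin _ cand0 U0.
by rewrite /earlier set0D last_index0.
Qed.

End Ses.

Section ShrinkingSes.
Variables (Ev : eqType) (c d t : Ev).
Hypotheses (dc : d <> c) (dt : d <> t) (ct : c <> t).

Definition shrinking_ses : SES Ev.
Proof.
refine (@MkSES Ev setT (fun _ _ => False) (fun e e' => e = c /\ e' = t)
  (fun d' c' t' => [/\ d' = d, c' = c & t' = t]) _ _ _ _ _ _) => //.
  by move=> _ [].
by move=> _ _ _ [-> -> ->].
Defined.

Lemma shrinking_trace_cdt : ses_trace shrinking_ses [:: c; d; t].
Proof.
split=> //.
  by rewrite /= !inE !negb_or; apply/and3P; split; rewrite ?andbT //;
    do ?[apply/andP; split]; apply/eqP => // /esym.
  by move=> e e' _ _ [].
case=> -[|[|[|//]]] ilt e /= z [[-> et] _] //=;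
  by rewrite /events /= !inE eqxx.
Qed.

Lemma shrinking_trace_dct : ses_trace shrinking_ses [:: d; c; t].
Proof.
split=> //.
  by rewrite /= !inE !negb_or; apply/and3P; split; rewrite ?andbT //;
    do ?[apply/andP; split]; apply/eqP.
  by move=> e e' _ _ [].
case=> -[|[|[|//]]] ilt e /= z [[-> et] _] //=;
  rewrite /events /= ?inE ?eqxx ?orbT //;
  by move: et; rewrite /e (tnth_nth c).
Qed.

(** The only initial cause of [t] is [c]; it is dropped exactly when [d] is in [U], and otherwise
    must itself belong to [U]. *)
Lemma shrinking_candidate (u : seq Ev) (i : 'I_(size u)) (U : set Ev) :
  tnth (in_tuple u) i = t -> U `<=` events (take i u) ->
  (cause_candidate shrinking_ses i U <-> U c \/ U d).
Proof.
move=> ui Ui; split=> [[_]|UcVd].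
  rewrite ui => Uic; have [Ud|nUd] := pselect (U d); [by right | left].
  by apply: Uic; split=> // -[d' Ud' [d'd _ _]]; rewrite d'd in Ud'.
split=> //; rewrite ui => z [[-> _] ndrop]; case: UcVd => // Ud.
by case: ndrop; exists d.
Qed.

Lemma shrinking_prec_cdt : ses_prec shrinking_ses [:: c; d; t] c t.
Proof.
have t2 : tnth (in_tuple [:: c; d; t]) (@Ordinal 3 2 isT) = t.
  by rewrite (tnth_nth c).
exists (@Ordinal 3 2 isT), [set c]; split=> //; split.
  apply/shrinking_candidate => //; last by left.
  by move=> z ->; rewrite /events /= !inE eqxx.
move=> U candU Uc; have [Usub _] := candU.
have Ud : U d.
  have [Uc'|//] := (shrinking_candidate t2 Usub).1 candU.
  apply: contrapT => nUd; apply: Uc; apply/seteqP; split=> z => [Uz|-> //].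
  have := Usub z Uz; rewrite /events /= !inE => /orP[]/eqP // zd.
  by rewrite zd in Uz.
(* The threshold 1 separates [c], whose 1-based index is 1, from [d], whose index is 2. *)
apply: (@leq_ltn_trans 1).
  apply: last_index_leq => -[[|[|[|//]]] ilt] //;
    by rewrite (tnth_nth c) /= => -[] // /esym.
have U1 : (U `\` [set c]) (tnth (in_tuple [:: c; d; t]) (@Ordinal 3 1 isT)).
  by rewrite (tnth_nth c).
exact: (ltn_last_index U1).
Qed.

Lemma shrinking_prec_dct (x y : Ev) :
  ses_prec shrinking_ses [:: d; c; t] x y -> x = d.
Proof.
(* The prefix is empty before [d] and is {d} before [c], so only the position of [t] remains, with
   [x = c] to be refuted. *)
case=> -[[|[|[|//]]] ilt] [U [[[Usub _] Umin] Ux _]];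
  have := Usub x Ux; rewrite /events /= ?inE //; first by move/eqP.
case/orP=> /eqP // xc; rewrite xc in Ux.
have t2 : tnth (in_tuple [:: d; c; t]) (Ordinal ilt) = t
  by rewrite (tnth_nth c).
have candd : cause_candidate shrinking_ses (Ordinal ilt) [set d].
  apply/shrinking_candidate => //; last by right.
  by move=> z ->; rewrite /events /= !inE eqxx.
have dU : [set d] <> U by move=> dU; rewrite -dU in Ux; case: dc.
(* A set containing [c], now of index 2, is not earlier than {d}, since [d] has index 1. *)
have := Umin _ candd dU; rewrite /earlier ltnNge => /negP[].
apply: (@leq_trans 1).
  apply: last_index_leq => -[[|[|[|//]]] jlt] //;
    by rewrite (tnth_nth c) /= => -[] // /esym.
have U1 : (U `\` [set d]) (tnth (in_tuple [:: d; c; t]) (@Ordinal 3 1 isT)).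
  by rewrite (tnth_nth c) /=; split=> // /esym.
exact: (ltnW (ltn_last_index U1)).
Qed.

Lemma shrinking_ses_not_ebes (x : EBES Ev) :
  ebes_posets x <> ses_posets shrinking_ses.
Proof.
move=> xs.
have eqC : events [:: d; c; t] = events [:: c; d; t].
  by apply/funext => z; rewrite /events /= !inE orbCA.
have P1 : ebes_posets x (eposet_of (events [:: c; d; t])
    (ses_prec shrinking_ses [:: c; d; t])).
  by rewrite xs; exists [:: c; d; t] => //; exact: shrinking_trace_cdt.
have P2 : ebes_posets x (eposet_of (events [:: c; d; t])
    (ses_prec shrinking_ses [:: d; c; t])).
  by rewrite xs; exists [:: d; c; t];
    [exact: shrinking_trace_dct | rewrite eqC].
(* Both traces have the same carrier, so their orders coincide, and [c] below [t] transfers to the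
   second trace, where only [d] lies strictly below anything. *)
have /seteqP[sub12 _] := ebes_posets_functional P1 P2.
have [|_ _ /=] := sub12 (c, t).
  split; rewrite /events /= ?inE ?eqxx ?orbT //.
  by apply: rt_step; exact: shrinking_prec_cdt.
by move/(clos_refl_trans_source shrinking_prec_dct) => [|/esym].
Qed.

End ShrinkingSes.

Section DisablingEbes.
Variables (Ev : eqType) (a b : Ev).
Hypothesis ab : a <> b.

Definition disabling_ebes : EBES Ev.
Proof.
refine (@MkEBES Ev setT (fun e e' => e = a /\ e' = b) (fun _ _ => False)
  _ _ _ _) => //.
by move=> e [-> /ab].
Defined.

Lemma disabling_posets1 (e : Ev) :
  exists R, ebes_posets disabling_ebes ([set e], R).
Proof.
have eE : events [:: e] = [set e].
  by apply/seteqP; split=> z; rewrite /events /= inE => /eqP.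
exists (eposet_of [set e] (ebes_prec disabling_ebes [set e])).2.
exists [set e] => //; exists [:: e] => //; split=> // i j.
by rewrite !ord1 => -[-> /ab].
Qed.

Lemma disabling_trace_ab : ebes_trace disabling_ebes [:: a; b].
Proof.
split=> //; first by rewrite /= inE andbT; apply/eqP.
by case=> -[|[|//]] ilt [[|[|//]] jlt];
  rewrite !(tnth_nth a) //= => -[] // /esym.
Qed.

Lemma disabling_ebes_not_ses (s : SES Ev) :
  ses_posets s <> ebes_posets disabling_ebes.
Proof.
move=> sx.
(* Every singleton is a configuration, as there are no bundles. *)
have ic0 e : ic s e = set0.
  by have [R] := disabling_posets1 e; rewrite -sx; exact: ses_posets1_ic.
pose C := events [:: a; b].
have : ebes_posets disabling_ebes (eposet_of C (ebes_prec disabling_ebes C)).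
  by exists C => //; exists [:: a; b] => //; exact: disabling_trace_ab.
rewrite -sx => -[t _ [_ /seteqP[_ subR]]].
have [Ca Cb] : C a /\ C b by rewrite /C /events /= !inE !eqxx orbT.
have [|_ _ /=] := subR (a, b).
  by split=> //; apply: rt_step; split=> //; left.
(* The relation is empty, so any source may be claimed; with [b], both outcomes of
   [clos_refl_trans_source] read [a = b]. *)
have prec0 u v : ses_prec s t u v -> u = b by move/(ic0_ses_prec (ic0 v)).
by move/(clos_refl_trans_source prec0) => [|].
Qed.

End DisablingEbes.

Theorem theorem4p17 (Ev : eqType) (Ev_inf : infinite_set [set: Ev]) :
  (exists s : SES Ev, forall x : EBES Ev, ebes_posets x <> ses_posets s) /\
  (exists x : EBES Ev, forall s : SES Ev, ses_posets s <> ebes_posets x).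
Proof.
have [t _] := infinite_setT_notin [::] Ev_inf.
have [c] := infinite_setT_notin [:: t] Ev_inf; rewrite inE => /eqP ct.
have [d] := infinite_setT_notin [:: c; t] Ev_inf.
rewrite !inE negb_or => /andP[/eqP dc /eqP dt].
split.
  by exists (shrinking_ses dc dt) => x; exact: shrinking_ses_not_ebes.
by exists (disabling_ebes ct) => s; exact: disabling_ebes_not_ses.
Qed.
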